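(* Let $A=\{a_k : k\ge 1\}$ be a null sequence of real numbers. Suppose that $$\log\left(\frac{a_n}{a_{n+1}}\right)=e^{\varphi(n)}\qquad\text{for all } n\ge 1,$$ where $\varphi:\mathbb N\to\mathbb R$ is strictly increasing and $\frac{\varphi(n)}{n}\to 0$ as $n\to\infty$. Then there exist compact sets $K\subseteq\mathbb R$ of Lebesgue measure arbitrarily close to $1$ (that is, for every $\eta>0$ there is a compact $K\subseteq\mathbb R$ with $|m(K)-1|<\eta$) such that the set $\mathcal E_K$ of Erdős points of $K$ has Hausdorff dimension $1$.
   Context: $m$ denotes Lebesgue measure on $\mathbb R$ and $\mathbb N=\{1,2,3,\dots\}$. A null sequence is an infinite sequence $A=\{a_k: k\ge 1\}$ with $a_k>0$ for all $k$, strictly decreasing to $0$. For a compact set $K\subseteq\mathbb R$, the set of Erdős points of $K$ (relative to $A$) is $$\mathcal E_K=\{x\in K:\ \forall\,\delta\in\mathbb R\setminus\{0\},\ \exists\,k\in\mathbb N \text{ such that } x+\delta a_k\notin K\}.$$ *)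

(* Defs.v *)
From mathcomp Require Import all_boot all_order all_algebra.
From mathcomp Require Import all_classical all_reals all_analysis.

Set Implicit Arguments.
Unset Strict Implicit.
Unset Printing Implicit Defensive.

Import Order.TTheory GRing.Theory Num.Theory.
Import numFieldNormedType.Exports.

Local Open Scope classical_set_scope.
Local Open Scope ring_scope.

(* Sequences (a_k) with k >= 1 are functions on nat whose value at 0 is
   irrelevant. *)
Definition null_sequence (R : realType) (a : nat -> R) : Prop :=
  [/\ forall k, (1 <= k)%N -> 0 < a k,
      forall k, (1 <= k)%N -> a k.+1 < a k
    & a k @[k --> \oo] --> (0 : R)].

Definition erdos_points (R : realType) (a : nat -> R) (K : set R) : set R :=
  [set x | K x /\ forall delta : R, delta != 0 ->
             exists k, (1 <= k)%N /\ ~ K (x + delta * a k)].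

(* 0 is added to the family so that the empty set has diameter 0 and not -oo. *)
Definition diameter (R : realType) (U : set R) : \bar R :=
  ereal_sup ([set 0%E] `|` [set `|x - y|%:E | x in U & y in U]).

Definition delta_cover (R : realType) (delta : R) (E : set R)
    (U : nat -> set R) : Prop :=
  E `<=` \bigcup_i U i /\ forall i, (diameter (U i) <= delta%:E)%E.

(* Empty members of the cover are skipped in the sum: they would otherwise
   contribute 0 `^ 0 = 1 when s = 0. *)
Definition hausdorff_premeasure (R : realType) (s delta : R) (E : set R)
    : \bar R :=
  ereal_inf [set (\sum_(i <oo | U i != set0) (diameter (U i)) `^ s)%E
            | U in delta_cover delta E].

Definition hausdorff_measure (R : realType) (s : R) (E : set R) : \bar R :=
  ereal_sup [set hausdorff_premeasure s delta E
            | delta in [set delta : R | 0 < delta]].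

Definition hausdorff_dim (R : realType) (E : set R) : \bar R :=
  ereal_inf [set s%:E | s in [set s : R | 0 <= s /\
                                          hausdorff_measure s E = 0%E]].

(* Main.v *)
Require Import Defs.
From mathcomp Require Import all_boot all_order all_algebra.
From mathcomp Require Import all_classical all_reals all_analysis.
From mathcomp Require Import measurable_realfun lra ring.

(** Idea of the proof.  Let x be a point of a compact set K, and suppose that
    for arbitrarily small scales K avoids an annulus l < |z - x| < rho.  A
    dilate d * a cannot jump over this annulus if consecutive terms of d * a
    near that scale have a ratio smaller than rho / l.  The choice
    rho = n * a_N, l = n * a_(N+1) / 2 does this for every |d| <= n whose first
    term d * a_1 is still outside: as the ratios a_k / a_(k+1) increase with k,
    the first term below rho is above l (dilate_hits_annulus).  So a point with
    such annuli for infinitely many n is an Erdos point.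

    It remains to find such points in dimension 1 while K keeps almost all its
    measure.  Take a Cantor set whose stage n + 1 puts m_n cores of length
    l_(n+1) at equal distances in each core of stage n, and remove from [0, 1],
    at each stage, the rho-neighbourhood of the cores except for the cores
    themselves (moated_set).  If M_n is the number of cores of stage n, then
    stage n costs at most 4 M_n rho_n in measure, which can be made small,
    whereas dimension 1 asks that M_n be about 1 / l_n up to a factor
    l_n ^ o(1).  The two demands are compatible when l_n >= rho_n ^ (1 + o(1)),
    which amounts to a_(N+1) >= a_N ^ (1 + c) for infinitely many N, for each
    c > 0.  This is where phi(n) / n -> 0 enters: otherwise ln (1 / a_N), hence
    also ln (a_N / a_(N+1)) = e ^ phi(N), would grow geometrically
    (subexponential_ratios_slow_decay).

    The lower bound on the dimension needs no measure on the Cantor set.  The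
    mixed radix expansion y |-> h(y) from [0, 1) into the Cantor set satisfies
    |y - z| <= C |h(y) - h(z)| ^ s for each s < 1
    (cantor_point_inverse_holder), so a cover of the Cantor set pulls back to a
    cover of [0, 1), whose Lebesgue measure is 1
    (hausdorff_measure_inverse_holder). *)

Set Implicit Arguments.
Unset Strict Implicit.
Unset Printing Implicit Defensive.

Import Order.TTheory GRing.Theory Num.Theory.
Import numFieldNormedType.Exports.
Local Open Scope classical_set_scope.
Local Open Scope ring_scope.

(** * Hausdorff measure and dimension on the line *)

Section Hausdorff.
Context {R : realType}.
Implicit Types (U E : set R) (s : R).

Lemma diameter_ge0 U : (0 <= diameter U)%E.
Proof. by apply: ereal_sup_ubound; left. Qed.

Lemma le_dist_diameter U x y : U x -> U y -> (`|x - y|%:E <= diameter U)%E.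
Proof. by move=> Ux Uy; apply: ereal_sup_ubound; right; exists x => //; exists y. Qed.

Lemma diameter_le U (d : R) : 0 <= d ->
  (forall x y, U x -> U y -> `|x - y| <= d) -> (diameter U <= d%:E)%E.
Proof.
move=> d0 Ud; apply: ge_ereal_sup => _ [->|[x Ux [y Uy <-]]].
  by rewrite lee_fin.
by rewrite lee_fin; exact: Ud.
Qed.

Lemma hausdorff_premeasure_ge0 s (d : R) E : (0 <= hausdorff_premeasure s d E)%E.
Proof.
apply: le_ereal_inf_tmp => _ [U _ <-].
by apply: nneseries_ge0 => *; exact: poweR_ge0.
Qed.

Lemma hausdorff_premeasure_le_measure s (d : R) E : 0 < d ->
  (hausdorff_premeasure s d E <= hausdorff_measure s E)%E.
Proof. by move=> d0; apply: ereal_sup_ubound; exists d. Qed.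

(** Cover by the N intervals of length 1 / N of the regular subdivision. *)
Lemma hausdorff_premeasure_grid s (d : R) E (N : nat) :
    E `<=` `[0, 1]%classic -> 0 <= s -> (0 < N)%N -> N%:R^-1 <= d ->
  (hausdorff_premeasure s d E <= (N%:R * N%:R^-1 `^ s)%:E)%E.
Proof.
move=> E01 s0 N0 Nd.
have N0' : 0 < N%:R :> R by rewrite ltr0n.
pose U i := if (i < N)%N then `[i%:R / N%:R, i.+1%:R / N%:R]%classic
            else set0 : set R.
have dU i : (diameter (U i) <= N%:R^-1%:E)%E.
  apply: diameter_le => [|x y]; first by rewrite invr_ge0.
  rewrite /U; case: ifP => // _.
  rewrite /= !in_itv/= => /andP[x1 x2] /andP[y1 y2].
  have := x2; have := y2; rewrite -addn1 natrD mulrDl mul1r => y3 x3.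
  rewrite ler_norml; lra.
apply: (@le_trans _ _ (\sum_(i <oo | U i != set0) (diameter (U i)) `^ s)%E).
  apply: ereal_inf_lbound; exists U => //; split; last first.
    by move=> i; apply: le_trans (dU i) _; rewrite lee_fin.
  move=> x /E01; rewrite /= in_itv/= => /andP[x0 x1].
  have [->|xn1] := eqVneq x 1.
    exists N.-1 => //; rewrite /U ltn_predL N0 /= in_itv/= prednK//.
    by rewrite divff ?gt_eqF// lexx ler_pdivrMr// mul1r ler_nat leq_pred.
  have xlt1 : x < 1 by rewrite lt_neqAle xn1.
  have xN0 : 0 <= x * N%:R by rewrite mulr_ge0.
  have /andP[tx1 tx2] := truncn_itv xN0.
  exists (Num.truncn (x * N%:R)) => //; rewrite /U truncn_lt_nat//.
  rewrite gtr_pMl// xlt1 /= in_itv/= ler_pdivrMr// tx1/= ler_pdivlMr//.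
  exact: ltW.
(* The members of index at least N are empty, so all partial sums are bounded
   by a sum of at most N equal terms. *)
apply: lime_le; first by apply: is_cvg_nneseries => *; exact: poweR_ge0.
apply: nearW => n.
apply: (@le_trans _ _ ((minn n N)%:R * N%:R^-1 `^ s)%:E); last first.
  by rewrite lee_fin ler_wpM2r ?powR_ge0// ler_nat geq_minr.
elim: n => [|n IH].
  by rewrite big_nil min0n mul0r.
rewrite big_mkcond big_nat_recr//= -big_mkcond/=.
have [nN|Nn] := ltnP n N.
  rewrite (_ : minn n.+1 N = (minn n N).+1); last first.
    by rewrite !(minn_idPl _)// ltnW.
  rewrite -addn1 natrD mulrDl mul1r EFinD leeD//.
  case: ifP => _; last by rewrite lee_fin powR_ge0.
  rewrite -poweR_EFin gt0_ler_poweR// ?in_itv/= ?diameter_ge0 ?leey//.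
  by rewrite lee_fin invr_ge0 ltW.
have -> : U n = set0 by rewrite /U ltnNge Nn.
rewrite eqxx/= adde0.
rewrite (minn_idPr (leqW Nn)).
by rewrite (minn_idPr Nn) in IH.
Qed.

(** The regular subdivisions give N * N ^ - s = N ^ (1 - s), which tends to 0. *)
Lemma hausdorff_measure_gt1 s E : E `<=` `[0, 1]%classic -> 1 < s ->
  hausdorff_measure s E = 0%E.
Proof.
move=> E01 s1; have sm1 : 0 < s - 1 by rewrite subr_gt0.
have s0 : 0 <= s by apply: ltW; exact: lt_trans s1.
suff pre0 d : 0 < d -> hausdorff_premeasure s d E = 0%E.
  apply/eqP; rewrite eq_le; apply/andP; split.
    by apply: ge_ereal_sup => _ [d /= d0 <-]; rewrite pre0.
  by rewrite -(pre0 1)// hausdorff_premeasure_le_measure.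
move=> d0; apply/eqP; rewrite eq_le hausdorff_premeasure_ge0 andbT.
apply/lee_addgt0Pr => e e0; rewrite add0e.
pose t := Num.min d (e `^ (s - 1)^-1).
have t0 : 0 < t by rewrite lt_min d0 powR_gt0.
pose N := (Num.truncn t^-1).+1.
have Nt : N%:R^-1 <= t.
  rewrite invf_ple ?posrE ?ltr0n//.
  have ti0 : 0 <= t^-1 by rewrite invr_ge0 ltW.
  by have /andP[_ /ltW] := truncn_itv ti0.
have N0 : 0 < N%:R :> R by rewrite ltr0n.
apply: (le_trans (@hausdorff_premeasure_grid s d E N E01 s0 _ _)) => //.
  by apply: (le_trans Nt); rewrite ge_min lexx.
have -> : s = 1 + (s - 1) by rewrite addrC subrK.
rewrite lee_fin powRD ?powRr1 ?invr_ge0 ?(ltW N0)//; last first.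
  by apply/implyP => _; rewrite invr_eq0 gt_eqF.
rewrite mulrA mulfV ?gt_eqF// mul1r.
apply: (@le_trans _ _ ((e `^ (s - 1)^-1) `^ (s - 1))).
  rewrite ge0_ler_powR ?nnegrE ?invr_ge0 ?powR_ge0 ?(ltW N0) ?(ltW sm1)//.
  by apply: (le_trans Nt); rewrite ge_min lexx orbT.
by rewrite -powRrM mulVf ?gt_eqF// powRr1// ltW.
Qed.

Lemma hausdorff_dim_le1 E : E `<=` `[0, 1]%classic -> (hausdorff_dim E <= 1)%E.
Proof.
move=> E01; apply/lee_addgt0Pr => e e0.
apply: ereal_inf_lbound; exists (1 + e) => //; split.
  by rewrite addr_ge0// ltW.
by apply: hausdorff_measure_gt1 => //; rewrite ltrDl.
Qed.

(** A cover of E by sets of diameter r_i pulls back under h to a cover of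
    [0, 1) by sets of diameter at most C * r_i ^ s, each contained in an
    interval of twice that length; hence 1 <= 2 C * sum r_i ^ s. *)
Lemma hausdorff_measure_inverse_holder (h : R -> R) s (C : R) E :
    0 <= s -> 0 < C ->
    (forall y, 0 <= y < 1 -> E (h y)) ->
    (forall y z, 0 <= y < 1 -> 0 <= z < 1 ->
       `|y - z| <= C * `|h y - h z| `^ s) ->
  hausdorff_measure s E != 0%E.
Proof.
move=> s0 C0 hE hol.
suff lb : ((C *+ 2)^-1%:E <= hausdorff_premeasure s 1 E)%E.
  rewrite gt_eqF//; apply: lt_le_trans (@hausdorff_premeasure_le_measure s 1 E ltr01).
  by apply: lt_le_trans lb; rewrite lte_fin invr_gt0 pmulrn_lgt0.
apply: le_ereal_inf_tmp => _ [U [EU dU] <-].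
pose r i := fine (diameter (U i)).
have rE i : diameter (U i) = (r i)%:E.
  rewrite fineK// ge0_fin_numE ?diameter_ge0//.
  exact: le_lt_trans (dU i) (ltry _).
have r0 i : 0 <= r i by rewrite -lee_fin -rE diameter_ge0.
pose D i := C * r i `^ s.
pose A i := [set y : R | 0 <= y < 1 /\ U i (h y)].
have c_choice : forall i, exists x, A i !=set0 -> A i x.
  move=> i; have [[y Ay]|nA] := pselect (A i !=set0); first by exists y.
  by exists 0.
have [c cA] := choice c_choice.
pose J i : set R := if pselect (A i !=set0) then
   `[c i - D i, c i + D i]%classic else set0.
have mJ i : measurable (J i).
  rewrite /J; case: pselect => [An|nA]; first exact: measurable_itv.
  exact: measurable0.
have covJ : `[0, 1[%classic `<=` \bigcup_i J i.
  move=> y; rewrite /= in_itv/= => y01.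
  have [i _ Uiy] := EU _ (hE _ y01); exists i => //.
  have Aiy : A i y by [].
  have A0 : A i !=set0 by exists y.
  rewrite /J; case: pselect => [An0|/(_ A0)//]; have [ci01 Uic] := cA i A0.
  have := hol _ _ y01 ci01.
  have : C * `|h y - h (c i)| `^ s <= D i.
    rewrite ler_wpM2l ?(ltW C0)// ge0_ler_powR ?nnegrE//.
    by rewrite -lee_fin -rE; exact: le_dist_diameter.
  move=> /[swap] /le_trans /[apply]; rewrite ler_norml /= in_itv/=.
  move=> /andP[? ?]; apply/andP; split; lra.
have m01 : lebesgue_measure (`[0, 1[%classic : set R) = 1%:E.
  by rewrite lebesgue_measure_itv/= lte_fin ltr01 oppr0 adde0.
have le1 : (1%:E <= \sum_(i <oo) lebesgue_measure (J i))%E.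
  rewrite -m01; apply: measure_sigma_subadditive => //.
have le2 : (\sum_(i <oo) lebesgue_measure (J i) <=
   \sum_(i <oo) (C *+ 2)%:E * (if U i != set0 then diameter (U i) `^ s else 0%E))%E.
  apply: lee_nneseries => // i _; rewrite /J; case: pselect => [An|nA].
    have [y [_ Uy]] := An; have /set0P -> : U i !=set0 by exists (h y).
    rewrite /= lebesgue_measure_itv/=; case: ifP => _.
      rewrite rE poweR_EFin -EFinD -EFinM lee_fin /D; lra.
    by rewrite mule_ge0// ?lee_fin ?mulrn_wge0 ?poweR_ge0// ltW.
  rewrite measure0 mule_ge0 ?lee_fin ?mulrn_wge0// ?(ltW C0)//.
  by case: ifP => // _; exact: poweR_ge0.
move: (le_trans le1 le2); rewrite nneseriesZl/=; last first.
  by move=> i _; case: ifP => // _; exact: poweR_ge0.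
rewrite -eseries_mkcond => H.
by rewrite -(@lee_pmul2l _ (C *+ 2)%:E) ?lte_fin ?pmulrn_lgt0// -EFinM divff// gt_eqF// pmulrn_lgt0.
Qed.

End Hausdorff.

(** * Null sequences and annuli *)

Section NullSequences.
Context {R : realType} (a : nat -> R).
Hypothesis ha : null_sequence a.

Let a_gt0 k : (1 <= k)%N -> 0 < a k. Proof. by case: ha => + _ _; exact. Qed.

Lemma null_sequence_small (e : R) : 0 < e ->
  exists N, forall k, (N <= k)%N -> (1 <= k)%N -> a k < e.
Proof.
case: ha => a0 _ /cvgrPdist_lt acvg e0.
have [N _ HN] := acvg e e0; exists N => k Nk k1.
have := HN k Nk; rewrite /= sub0r normrN gtr0_norm//; exact: a0.
Qed.

Lemma null_sequence_le j k : (1 <= j)%N -> (j <= k)%N -> a k <= a j.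
Proof.
move=> j1; elim: k => [|k IH]; first by rewrite leqn0 => /eqP ->.
rewrite leq_eqVlt => /orP[/eqP -> //|]; rewrite ltnS => jk.
apply: le_trans (IH jk); apply: ltW; case: ha => _ + _; apply.
exact: leq_trans jk.
Qed.

Lemma null_sequence_lt j k : (1 <= j)%N -> (j < k)%N -> a k < a j.
Proof.
move=> j1 jk; apply: le_lt_trans (null_sequence_le _ jk) _ => //.
by case: ha => _ + _; exact.
Qed.

(** If a_(N+1) < a_N ^ (1 + c) for all large N, then - ln a_N gets multiplied by
    at least 1 + c at each step, so that its increments e ^ phi(N) are at least
    a constant times (1 + c) ^ N, and phi grows linearly. *)
Lemma subexponential_ratios_slow_decay (phi : nat -> R) (c : R) (N0 : nat) :
    (forall n, (1 <= n)%N -> ln (a n / a n.+1) = expR (phi n)) ->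
    phi n / n%:R @[n --> \oo] --> (0 : R) ->
    0 < c ->
  exists N, [/\ (1 <= N)%N, (N0 <= N)%N & a N `^ (1 + c) <= a N.+1].
Proof.
move=> hlog hlim c0; apply: contrapT => noN.
have fast N : (1 <= N)%N -> (N0 <= N)%N -> a N.+1 < a N `^ (1 + c).
  by move=> N1 NN; rewrite ltNge; apply/negP => ?; apply: noN; exists N.
have [N' smallN'] := null_sequence_small (expR_gt0 (- 1)).
(* From N1 on a is below e ^ -1, so that the geometric growth starts at 1. *)
pose N1 := maxn 1 (maxn N0 N').
have N1_1 k : (1 <= N1 + k)%N by rewrite (leq_trans _ (leq_addr _ _))// leq_maxl.
have N1_0 k : (N0 <= N1 + k)%N.
  by rewrite (leq_trans _ (leq_addr _ _))// /N1 !leq_max leqnn orbT.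
have N1_' : (N' <= N1)%N by rewrite /N1 !leq_max leqnn !orbT.
have c10 : 0 < 1 + c by rewrite addr_gt0.
have lnstep k : ln (a (N1 + k).+1) < (1 + c) * ln (a (N1 + k)).
  by rewrite -ln_powR ltr_ln ?posrE ?powR_gt0 ?a_gt0// fast.
have lnlow k : ln (a (N1 + k)) <= - (1 + c) ^+ k.
  elim: k => [|k IH].
    rewrite addn0 expr0 -[leRHS]expRK ler_ln ?posrE ?expR_gt0//; last first.
      by rewrite a_gt0// -(addn0 N1).
    by apply: ltW; apply: smallN' => //; rewrite -(addn0 N1).
  rewrite addnS (le_trans (ltW (lnstep k)))// exprS -mulrN ler_wpM2l//.
  exact: ltW.
(* phi grows at slope at least 2 * t, yet is eventually below slope t. *)
pose t := ln (1 + c) / 2.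
have ln0 : 0 < ln (1 + c) by rewrite ln_gt0// ltrDl.
have t0 : 0 < t by rewrite divr_gt0.
have philow k : ln c + k%:R * ln (1 + c) <= phi (N1 + k).
  rewrite -ler_expR -hlog// expRD lnK ?posrE// mulr_natl -lnXn// lnK ?posrE ?exprn_gt0//.
  rewrite ln_div ?posrE ?a_gt0//.
  have := lnstep k; have := lnlow k; move: (ln (a (N1 + k).+1)) (ln (a (N1 + k))) ((1 + c) ^+ k) => y x z.
  move=> h1 h2; have : c * z <= c * - x by rewrite ler_pM2l//; lra.
  lra.
move/cvgrPdist_lt : hlim => /(_ t t0)[N2 _ HN2].
pose k := maxn N2 (Num.truncn (`|t * N1%:R - ln c| / t)).+1.
have kN2 : (N2 <= N1 + k)%N by rewrite (leq_trans _ (leq_addl _ _))// leq_maxl.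
have := HN2 _ kN2; rewrite /= sub0r normrN => /ltr_normlW.
rewrite ltr_pdivrMr ?ltr0n// => phiup.
have kt : `|t * N1%:R - ln c| < t * k%:R.
  rewrite [ltRHS]mulrC -ltr_pdivrMr//.
  have q0 : 0 <= `|t * N1%:R - ln c| / t by rewrite divr_ge0// ltW.
  have /andP[_ q1] := truncn_itv q0; apply: lt_le_trans q1 _.
  by rewrite ler_nat leq_maxr.
have := ltr_normlW kt; have := philow k; move: phiup.
rewrite natrD (_ : ln (1 + c) = 2 * t); last by rewrite /t mulrC divfK.
by move=> *; lra.
Qed.

(** Let d * a_(j+1) be the first term below M * a_N.  Its predecessor satisfies
    M * a_j >= d * a_j >= M * a_N, so j <= N, and the ratio a_j / a_(j+1) is at
    most a_N / a_(N+1): the term cannot have fallen below M * a_(N+1). *)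
Lemma dilate_hits_annulus (N : nat) (M d : R) :
    (forall j k, (1 <= j)%N -> (j <= k)%N -> a j / a j.+1 <= a k / a k.+1) ->
    (1 <= N)%N -> 0 < d <= M -> M * a N <= d * a 1%N ->
  exists k, [/\ (1 <= k)%N, M * a N.+1 <= d * a k & d * a k < M * a N].
Proof.
move=> ratio N1 /andP[d0 dM] first_out.
have M0 : 0 < M by exact: lt_le_trans dM.
pose P k := (1 <= k)%N && (d * a k < M * a N).
have exP : exists k, P k.
  have [K HK] := null_sequence_small (divr_gt0 (mulr_gt0 M0 (a_gt0 N1)) d0).
  exists (maxn 1 K); rewrite /P leq_maxl/= mulrC -ltr_pdivlMr//.
  by apply: HK; rewrite ?leq_maxr ?leq_maxl.
have := ex_minnP exP; case; move=> [|[|j]]; rewrite {1}/P//=.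
  by rewrite ltNge first_out.
move=> into minj; exists j.+2; split => //.
have out : M * a N <= d * a j.+1.
  rewrite leNgt; apply/negP => lt; have /minj : P j.+1 by rewrite /P.
  by rewrite ltnn.
have jN : (j.+1 <= N)%N.
  rewrite leqNgt; apply/negP => Nj; have := null_sequence_lt N1 Nj.
  rewrite ltNge => /negP; apply.
  by rewrite -(ler_pM2l M0); apply: le_trans out _; rewrite ler_wpM2r// ltW// a_gt0.
have := ratio j.+1 N isT jN.
have aN := a_gt0 N1; have aN' : 0 < a N.+1 by exact: a_gt0.
have aj : 0 < a j.+2 by exact: a_gt0.
rewrite ler_pdivrMr// mulrAC ler_pdivlMr// => r.
rewrite -(ler_pM2l aN) mulrCA.
have := ler_wpM2r (ltW aN') out; have := ler_wpM2l (ltW d0) r.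
move=> h1 h2; lra.
Qed.

(** One stage of the construction: inside a given core of length of order e
    there is room for m cores of length l surrounded by annuli of outer radius
    rho, with m so large that the exponent 1 - 1/n of the dimension is reached.
    With a_(N+1) >= a_N ^ (1 + 1/n) one gets
    l ^ (1 - 1/n) >= a_N ^ (1 - 1/n^2) / 2, which exceeds any given multiple of
    a_N once a_N is small, and m is about e / (n * a_N). *)
Lemma annulus_step (n : nat) (e : R) :
    (forall j k, (1 <= j)%N -> (j <= k)%N -> a j / a j.+1 <= a k / a k.+1) ->
    (forall c N0, 0 < c -> exists N,
       [/\ (1 <= N)%N, (N0 <= N)%N & a N `^ (1 + c) <= a N.+1]) ->
    (1 <= n)%N -> 0 < e ->
  exists (m : nat) (l rho : R),
    [/\ [/\ (2 <= m)%N, 0 < l, l <= rho & rho * m%:R <= e],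
        1 <= m%:R * l `^ (1 - n%:R^-1)
      & forall d, 0 < d <= n%:R -> rho <= d * a 1%N ->
          exists k, [/\ (1 <= k)%N, l < d * a k & d * a k < rho] ].
Proof.
move=> ratio slow n1 e0.
have n0 : 0 < n%:R :> R by rewrite ltr0n.
have n1R : 1 <= n%:R :> R by rewrite ler1n.
have e4n0 : 0 < e / (4 * n%:R) by rewrite divr_gt0// mulr_gt0.
(* The first bound on a_N gives m >= 2, the second a_N ^ (1/n^2) <= e / (4 n). *)
pose t := Num.min (e / (2 * n%:R)) ((e / (4 * n%:R)) `^ (n%:R * n%:R)).
have t0 : 0 < t by rewrite lt_min powR_gt0// andbT divr_gt0// mulr_gt0.
have [N0 smallN0] := null_sequence_small t0.
have ni0 : 0 < n%:R^-1 :> R by rewrite invr_gt0.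
have ni1 : n%:R^-1 <= 1 :> R by rewrite invf_le1.
have [N [N1 NN0 slowN]] := slow n%:R^-1 N0 ni0.
have aN := a_gt0 N1; have aN' : 0 < a N.+1 by exact: a_gt0.
have := smallN0 _ NN0 N1; rewrite lt_min => /andP[small1 small2].
pose rho := n%:R * a N; pose l := n%:R * a N.+1 / 2.
have rho0 : 0 < rho by rewrite mulr_gt0.
have l0 : 0 < l by rewrite divr_gt0// mulr_gt0.
pose m := Num.truncn (e / rho).
have er0 : 0 <= e / rho by rewrite divr_ge0// ltW.
have /andP[m_le m_gt] := truncn_itv er0; rewrite -/m in m_le m_gt.
have m2 : (2 <= m)%N.
  rewrite truncn_ge_nat// ler_pdivlMr// /rho mulrA -ler_pdivlMl ?mulr_gt0//.
  by rewrite mulrC ltW.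
exists m, l, rho; split.
- split => //.
    have : n%:R * a N.+1 <= rho by rewrite /rho ler_pM2l// null_sequence_le.
    have : 0 < n%:R * a N.+1 by rewrite mulr_gt0.
    rewrite /l; move: (_ * _) => x *; lra.
  by rewrite mulrC -ler_pdivlMr.
- set p := 1 - n%:R^-1; have p0 : 0 <= p by rewrite subr_ge0.
  have p1 : p <= 1 by rewrite gerBl ltW.
  have m_big : e / rho <= 2 * m%:R.
    have : m.+1%:R <= 2 * m%:R :> R by rewrite -natrM ler_nat mul2n -addnn -addn1 leq_add2l ltnW.
    by apply: le_trans; exact: ltW.
  have lp : 2^-1 * a N.+1 `^ p <= l `^ p.
    apply: (@le_trans _ _ ((2^-1 * a N.+1) `^ p)).
      rewrite powRM ?invr_ge0 ?(ltW aN')// ler_wpM2r ?powR_ge0// ger1_powR//.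
      by rewrite invr_gt0 invf_le1// ltr0n ler1n.
    rewrite ge0_ler_powR ?nnegrE ?mulr_ge0 ?invr_ge0 ?(ltW aN') ?(ltW l0)//.
    by rewrite /l mulrC ler_pM2r ?invr_gt0// ler_peMl ?(ltW aN').
  have a_root : a N `^ (n%:R^-1 * n%:R^-1) <= e / (4 * n%:R).
    have nn1 : (n%:R * n%:R) * (n%:R^-1 * n%:R^-1) = 1 :> R.
      by rewrite mulrACA divff ?gt_eqF// mulr1.
    move: (e / _) e4n0 small2 => x x0 small2.
    rewrite -[leRHS](powRr1 (ltW x0)) -[X in _ <= _ `^ X]nn1 [leRHS]powRrM.
    rewrite ge0_ler_powR ?nnegrE ?powR_ge0 ?mulr_ge0 ?(ltW ni0) ?(ltW aN)//.
    exact: ltW.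
  have a_p : a N / (e / (4 * n%:R)) <= a N.+1 `^ p.
    apply: (@le_trans _ _ ((a N `^ (1 + n%:R^-1)) `^ p)); last first.
      by rewrite ge0_ler_powR ?nnegrE ?powR_ge0// ltW.
    rewrite -powRrM (_ : _ * p = 1 - n%:R^-1 * n%:R^-1); last by rewrite /p; ring.
    rewrite powRB ?(gt_eqF aN) ?implybT// powRr1 ?(ltW aN)// ler_pM2l//.
    by rewrite lef_pV2 ?posrE ?powR_gt0.
  rewrite [leLHS](_ : 1 = (e / rho / 2) * (2^-1 * (a N / (e / (4 * n%:R)))));
    last first.
    by rewrite /rho; field; rewrite !gt_eqF.
  apply: ler_pM.
  + by rewrite divr_ge0.
  + by rewrite mulr_ge0 ?invr_ge0// divr_ge0 ?(ltW aN) ?(ltW e4n0).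
  + by rewrite ler_pdivrMr// [leRHS]mulrC.
  + by apply: le_trans lp; rewrite ler_pM2l ?invr_gt0.
- move=> d dn d1; have [k [k1 k2 k3]] := dilate_hits_annulus ratio N1 dn d1.
  exists k; split => //; apply: lt_le_trans k2.
  have : 0 < n%:R * a N.+1 by rewrite mulr_gt0.
  by rewrite /l; move: (_ * _) => x *; lra.
Qed.

Lemma null_sequence_ratio_le (phi : nat -> R) :
    (forall n, (1 <= n)%N -> ln (a n / a n.+1) = expR (phi n)) ->
    (forall m n, (1 <= m)%N -> (m < n)%N -> phi m < phi n) ->
  forall j k, (1 <= j)%N -> (j <= k)%N -> a j / a j.+1 <= a k / a k.+1.
Proof.
move=> hlog hphi j k j1 jk; have k1 := leq_trans j1 jk.
rewrite -ler_ln ?posrE ?divr_gt0 ?a_gt0// !hlog// ler_expR.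
by move: jk; rewrite leq_eqVlt => /orP[/eqP -> //|jk]; apply/ltW/hphi.
Qed.

End NullSequences.

(** * Cantor sets surrounded by moats *)

Fixpoint cells (m : nat -> nat) (n : nat) : nat :=
  if n is n'.+1 then (cells m n' * m n')%N else 1%N.

(** Cells of stage n.+1 are numbered so that the parent of p is p %/ m n. *)
Fixpoint endpoint {R : realType} (m : nat -> nat) (l : nat -> R) (n p : nat) : R :=
  if n is n'.+1 then
    endpoint m l n' (p %/ m n') + (p %% m n')%:R * (l n' / (m n')%:R)
  else 0.

Definition digits {R : realType} (m : nat -> nat) (n : nat) (y : R) : nat :=
  Num.truncn (y * (cells m n)%:R).

Definition cantor_point {R : realType} (m : nat -> nat) (l : nat -> R) (y : R) : R :=
  sup (range (fun n => endpoint m l n (digits m n y))).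

Definition cores {R : realType} (m : nat -> nat) (l : nat -> R) (n : nat) : set R :=
  \bigcup_(p in `I_(cells m n)) `[endpoint m l n p, endpoint m l n p + l n]%classic.

Definition surroundings {R : realType} (m : nat -> nat) (l rho : nat -> R) (n : nat)
    : set R :=
  \bigcup_(p in `I_(cells m n))
    `]endpoint m l n p - (rho n + l n), endpoint m l n p + (rho n + l n)[%classic.

Definition moated_set {R : realType} (m : nat -> nat) (l rho : nat -> R) : set R :=
  `[0, 1]%classic `&` \bigcap_n (~` surroundings m l rho n.+1 `|` cores m l n.+1).

Section MoatedCantorSet.
Context {R : realType} (m : nat -> nat) (l rho : nat -> R).

Local Notation M := (cells m).
Local Notation c := (endpoint m l).
Local Notation h := (cantor_point m l).
Local Notation K := (moated_set m l rho).

Lemma compact_moated_set : compact K.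
Proof.
apply: (subclosed_compact _ (@segment_compact R 0 1)) => [|x []//].
apply: closedI; first exact: interval_closed.
apply: closed_bigI => n _; apply: closedU.
  apply: open_closedC; apply: bigcup_open => p _; exact: interval_open.
apply: closed_bigcup; first exact: finite_II.
by move=> p _; exact: interval_closed.
Qed.

Hypothesis m_ge2 : forall n, (2 <= m n)%N.
Hypothesis l_0 : l 0%N = 1.
Hypothesis l_gt0 : forall n, 0 < l n.
Hypothesis l_le_rho : forall n, l n <= rho n.
Hypothesis rho_fit : forall n, 2 * rho n.+1 * (m n)%:R <= l n.

Let m_gt0 n : (0 < m n)%N. Proof. exact: ltnW. Qed.
Let mR_gt0 n : 0 < (m n)%:R :> R. Proof. by rewrite ltr0n. Qed.
Let rho_gt0 n : 0 < rho n. Proof. exact: lt_le_trans (l_le_rho n). Qed.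

Lemma surroundings_measure_le n :
  (lebesgue_measure (surroundings m l rho n) <= ((M n)%:R * (4 * rho n))%:E)%E.
Proof.
pose F p := `]c n p - (rho n + l n), c n p + (rho n + l n)[%classic : set R.
have mF p : measurable (F p) by exact: measurable_itv.
have -> : surroundings m l rho n = \big[setU/set0]_(p < M n) F p.
  by rewrite -bigcup_mkord.
apply: (@le_trans _ _ (\sum_(p < M n) lebesgue_measure (F p))%E).
  by apply: (Boole_inequality lebesgue_measure) => p _; exact: mF.
apply: (@le_trans _ _ (\sum_(p < M n) (4 * rho n)%:E)%E).
  apply: lee_sum => p _; rewrite lebesgue_measure_itv/=; case: ifP => _.
    by rewrite -EFinD lee_fin; have := l_le_rho n; lra.
  by rewrite lee_fin mulr_ge0// ltW.
by rewrite sumEFin sumr_const card_ord lee_fin [leRHS]mulr_natl.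
Qed.

(** [0, 1] is covered by K and the surroundings of the cores of all stages. *)
Lemma moated_set_measure (e : R) :
    (forall n, (M n.+1)%:R * (4 * rho n.+1) <= e / (2 ^ n.+1)%:R) ->
  (`|lebesgue_measure K - 1| <= e%:E)%E.
Proof.
move=> area.
have e0 : 0 <= e.
  have := area 0%N; rewrite ler_pdivlMr ?ltr0n// => /(le_trans _); apply.
  by rewrite !mulr_ge0// ltW.
have mK : measurable K.
  by apply: compact_measurable; exact: compact_moated_set.
have mS n : measurable (surroundings m l rho n).
  by apply: bigcup_measurable => p _; exact: measurable_itv.
have mSU : measurable (\bigcup_n surroundings m l rho n.+1).
  by apply: bigcup_measurable => n _; exact: mS.
have m01 : lebesgue_measure (`[0, 1]%classic : set R) = 1%:E.
  by rewrite lebesgue_measure_itv/= lte_fin ltr01 oppr0 adde0.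
have K1 : (lebesgue_measure K <= 1)%E.
  by rewrite -m01 le_measure ?inE// => x [].
have S_le : (lebesgue_measure (\bigcup_n surroundings m l rho n.+1) <= e%:E)%E.
  apply: (@le_trans _ _ (\sum_(n <oo) lebesgue_measure (surroundings m l rho n.+1))%E).
    by apply: generalized_Boole_inequality => // n; exact: mS.
  apply: le_trans (epsilon_trick0 xpredT e0).
  apply: lee_nneseries => // n _.
  by apply: le_trans (surroundings_measure_le _) _; rewrite lee_fin.
have lower : (1 <= lebesgue_measure K + e%:E)%E.
  apply: (@le_trans _ _ (lebesgue_measure (K `|` \bigcup_n surroundings m l rho n.+1))).
    rewrite -m01 le_measure ?inE//.
      exact: measurableU.
    move=> x x01; have [xS|xS] := pselect ((\bigcup_n surroundings m l rho n.+1) x).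
      by right.
    left; split => // n _; left => Sx; apply: xS; by exists n.
  apply: le_trans (measureU2 _ _ _) _ => //.
  by rewrite leeD2l.
have Kfin : lebesgue_measure K \is a fin_num.
  by rewrite ge0_fin_numE ?measure_ge0//; exact: le_lt_trans K1 (ltry _).
move: K1 lower; rewrite -(fineK Kfin) -EFinB -EFinD !lee_fin => K1 lower.
rewrite ler_norml; apply/andP; split; lra.
Qed.

Let step_ge n : 2 * rho n.+1 <= l n / (m n)%:R.
Proof. by rewrite ler_pdivlMr. Qed.

Let step_gt0 n : 0 < l n / (m n)%:R. Proof. by rewrite divr_gt0. Qed.

Lemma endpoint_child_ge n p : c n (p %/ m n) <= c n.+1 p.
Proof. by rewrite /= lerDl mulr_ge0// ltW. Qed.

Lemma endpoint_child_le n p :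
  c n.+1 p + l n / (m n)%:R <= c n (p %/ m n) + l n.
Proof.
rewrite /= -addrA lerD2l -[X in _ + X <= _]mul1r -mulrDl natr1 mulrCA.
by rewrite ler_piMr ?(ltW (l_gt0 n))// ler_pdivrMr// mul1r ler_nat ltn_mod.
Qed.

Lemma endpoint_sibling n p q : (p %/ m n = q %/ m n)%N -> (p <= q)%N ->
  c n.+1 q = c n.+1 p + (q - p)%:R * (l n / (m n)%:R).
Proof.
move=> pq leq; rewrite /= pq -addrA -mulrDl -natrD; congr (_ + _%:R * _).
rewrite {2}(divn_eq q (m n)) [in X in (_ - X)%N](divn_eq p (m n)) pq subnDl addnC subnK//.
by move: leq; rewrite {1}(divn_eq q (m n)) {1}(divn_eq p (m n)) pq leq_add2l.
Qed.

(** Siblings are one step l_n / m_n >= 2 * rho_(n+1) apart.  For different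
    parents, the last child of a core starts a full step before the right end
    of this core, and the next core begins beyond that end. *)
Lemma endpoint_separated n p q : (p < q)%N -> (q < M n)%N ->
  c n p + 2 * rho n <= c n q.
Proof.
elim: n p q => [|n IH] p q pq qM; first by move: qM pq; case: q.
have [same|neq] := eqVneq (p %/ m n)%N (q %/ m n)%N.
  rewrite (endpoint_sibling same (ltnW pq)) lerD2l (le_trans (step_ge n))//.
  by rewrite ler_peMl ?(ltW (step_gt0 n))// ler1n subn_gt0.
have lt : (p %/ m n < q %/ m n)%N by rewrite ltn_neqAle neq leq_div2r// ltnW.
have qM' : (q %/ m n < M n)%N by rewrite ltn_divLR.
have := IH _ _ lt qM'; have := endpoint_child_ge n q.
have := endpoint_child_le n p; have := step_ge n.
have := l_le_rho n; have := rho_gt0 n; lra.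
Qed.

Lemma digits_div n (y : R) : 0 <= y -> (digits m n.+1 y %/ m n = digits m n y)%N.
Proof.
move=> y0; rewrite /digits /=; apply/esym; apply: truncn_def.
have z0 : 0 <= y * (M n * m n)%:R by rewrite mulr_ge0.
have /andP[] := truncn_itv z0; set t := Num.truncn _ => t1 t2.
rewrite natrM mulrA in t1 t2.
apply/andP; split.
  rewrite -(ler_pM2r (mR_gt0 n)); apply: le_trans t1.
  by rewrite -natrM ler_nat leq_divM.
rewrite -(ltr_pM2r (mR_gt0 n)); apply: lt_le_trans t2 _.
by rewrite -natrM ler_nat ltn_ceil.
Qed.

Lemma cells_gt0 n : (0 < M n)%N.
Proof. by elim: n => //= n IH; rewrite muln_gt0 IH m_gt0. Qed.

Lemma cells_gt n : (n < M n)%N.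
Proof.
elim: n => //= n IH; apply: (@leq_trans (M n * 2)); last by rewrite leq_mul2l m_ge2 orbT.
by rewrite muln2 -addnn -addn1 leq_add// cells_gt0.
Qed.

Lemma digits_lt n (y : R) : 0 <= y < 1 -> (digits m n y < M n)%N.
Proof.
move=> /andP[y0 y1]; rewrite truncn_lt_nat ?mulr_ge0//.
by rewrite gtr_pMl// ltr0n cells_gt0.
Qed.

(** The cores of the digits of y form a nested sequence of intervals. *)
Lemma cantor_point_bounds n (y : R) : 0 <= y ->
  c n (digits m n y) <= h y <= c n (digits m n y) + l n.
Proof.
move=> y0; pose u n := c n (digits m n y).
have u_le k : u k <= u k.+1 by rewrite /u -(digits_div k y0) endpoint_child_ge.
have v_le k : u k.+1 + l k.+1 <= u k + l k.
  rewrite /u -(digits_div k y0); apply: le_trans (endpoint_child_le _ _).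
  rewrite lerD2l; apply: le_trans (step_ge k).
  have := l_le_rho k.+1; have := rho_gt0 k.+1; lra.
have u_mono : {homo u : i j / (i <= j)%N >-> i <= j} by apply: homo_leq => //; exact: le_trans.
have v_mono : {homo (fun k => u k + l k) : i j / (i <= j)%N >-> j <= i}.
  by apply: homo_leq => // ? ? ? /[swap]; exact: le_trans.
have uv i j : u i <= u j + l j.
  apply: (le_trans (u_mono _ _ (leq_maxl i j))).
  apply: (le_trans _ (v_mono _ _ (leq_maxr i j))).
  by rewrite lerDl ltW.
apply/andP; split.
  apply: ub_le_sup; last by exists n.
  by exists (u 0%N + l 0%N) => _ [k _ <-]; exact: uv.
apply: ge_sup; first by exists (u 0%N), 0%N.
by move=> _ [k _ <-]; exact: uv.
Qed.

Lemma cantor_point_in_core n (y : R) : 0 <= y < 1 -> cores m l n (h y).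
Proof.
move=> y01; exists (digits m n y); first exact: digits_lt.
by rewrite /= in_itv/=; apply: cantor_point_bounds; case/andP: y01.
Qed.

Lemma cantor_point_moated (y : R) : 0 <= y < 1 -> K (h y).
Proof.
move=> y01; split; last by move=> n _; right; exact: cantor_point_in_core.
by have [p _] := cantor_point_in_core 0%N y01; rewrite /= l_0 add0r.
Qed.

(** A point of the annulus around x is too far from x to be in the core of x and
    too close to be in another core, as these are 2 * rho - l away. *)
Lemma annulus_misses_cores n x z : cores m l n x ->
  l n < `|z - x| < rho n -> surroundings m l rho n z /\ ~ cores m l n z.
Proof.
move=> [p /= pM]; rewrite in_itv/= => /andP[x1 x2] /andP[z1 z2].
have ll := l_gt0 n; have rr := l_le_rho n.
split.
  exists p => //=; rewrite in_itv/=.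
  by move: z2; rewrite ltr_norml => /andP[? ?]; apply/andP; split; lra.
move=> [q /= qM]; rewrite in_itv/= => /andP[z3 z4]; have [pq|qp|eqpq] := ltngtP p q.
- by have := endpoint_separated pq qM; move: z2; rewrite ltr_norml => /andP[? ?] ?; lra.
- by have := endpoint_separated qp pM; move: z2; rewrite ltr_norml => /andP[? ?] ?; lra.
- move: z1; rewrite ltNge => /negP; apply; rewrite -eqpq in z3 z4.
  by rewrite ler_norml; apply/andP; split; lra.
Qed.

Lemma cantor_point_erdos (a : nat -> R) (y : R) :
    (forall d, 0 < d -> exists n k,
       [/\ (1 <= k)%N, 0 < a k, l n.+1 < d * a k & d * a k < rho n.+1]) ->
  0 <= y < 1 -> erdos_points a K (h y).
Proof.
move=> hit y01; split; first exact: cantor_point_moated.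
move=> d dn0; have d0 : 0 < `|d| by rewrite normr_gt0.
have [n [k [k1 ak lk rk]]] := hit _ d0.
exists k; split => // -[_ /(_ n I)].
have dist : l n.+1 < `|h y + d * a k - h y| < rho n.+1.
  by rewrite addrAC subrr add0r normrM (gtr0_norm ak) lk.
by have [Sz nCz] := annulus_misses_cores (cantor_point_in_core n.+1 y01) dist; case.
Qed.

Lemma core_le n k : (n <= k)%N -> l k <= l n.
Proof.
have l_le i : l i.+1 <= l i.
  apply: (le_trans _ (rho_fit i)); apply: (le_trans (l_le_rho _)).
  have r0 := rho_gt0 i.+1; apply: (@le_trans _ _ (2 * rho i.+1)); first lra.
  by rewrite ler_peMr ?mulr_ge0 ?(ltW r0)// ler1n.
have l_mono : {homo l : i j / (i <= j)%N >-> j <= i}.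
  by apply: homo_leq => // ? ? ? /[swap]; exact: le_trans.
exact: l_mono.
Qed.

Hypothesis many_cells :
  forall n, 1 <= (M n)%:R * l n `^ (1 - n%:R^-1).

(** Once 1/n <= 1 - s this is the hypothesis on the number of cells; the finitely
    many remaining stages are absorbed in the constant. *)
Lemma cells_lower_bound (s : R) : 0 <= s < 1 ->
  exists2 C : R, 0 < C & forall n, 1 <= C * ((M n)%:R * l n `^ s).
Proof.
move=> /andP[s0 s1]; have s1' : 0 < 1 - s by rewrite subr_gt0.
pose n0 := (Num.truncn (1 - s)^-1).+1.
have n0_s : n0%:R^-1 <= 1 - s.
  have i0 : 0 <= (1 - s)^-1 by rewrite invr_ge0 ltW.
  rewrite invf_ple ?posrE ?ltr0n//.
  by have /andP[_ /ltW] := truncn_itv i0.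
have l_le1 n : l n <= 1 by rewrite -l_0 core_le.
have M1 n : 1 <= (M n)%:R :> R by rewrite ler1n cells_gt0.
exists ((l n0 `^ s)^-1); first by rewrite invr_gt0 powR_gt0.
move=> n; rewrite ler_pdivlMl ?powR_gt0// mulr1.
have [nn0|n0n] := leqP n0 n.
  apply: (@le_trans _ _ 1).
    rewrite -[leRHS](powRr0 (l n0)); apply: ger_powR => //.
    by rewrite l_gt0 l_le1.
  apply: le_trans (many_cells n) _; rewrite ler_wpM2l//.
  apply: ger_powR; first by rewrite l_gt0 l_le1.
  suff : n%:R^-1 <= n0%:R^-1 :> R by move: n0_s; lra.
  by rewrite lef_pV2 ?posrE ?ltr0n ?ler_nat// (leq_trans _ nn0).
apply: (@le_trans _ _ (l n `^ s)).
  by rewrite ge0_ler_powR ?nnegrE ?(ltW (l_gt0 _))// core_le// ltnW.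
by rewrite ler_peMl ?powR_ge0.
Qed.

Lemma first_digit_difference (y z : R) : 0 <= y -> y < z -> z < 1 -> exists n,
  (digits m n.+1 y < digits m n.+1 z)%N /\
  (digits m n.+1 y %/ m n = digits m n.+1 z %/ m n)%N.
Proof.
move=> y0 yz z1; have z0 : 0 <= z by rewrite (le_trans y0)// ltW.
have y01 : 0 <= y < 1 by rewrite y0 (lt_trans yz).
have z01 : 0 <= z < 1 by rewrite z0.
have yM n : 0 <= y * (M n)%:R by rewrite mulr_ge0.
have zM n : 0 <= z * (M n)%:R by rewrite mulr_ge0.
have digits_le n : (digits m n y <= digits m n z)%N.
  rewrite truncn_ge_nat//; have /andP[+ _] := truncn_itv (yM n).
  by move=> /le_trans; apply; rewrite ler_wpM2r// ltW.
have exN : exists n, digits m n y != digits m n z.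
  have zy0 : 0 < z - y by rewrite subr_gt0.
  have zyi0 : 0 <= (z - y)^-1 by rewrite invr_ge0 ltW.
  pose N := (Num.truncn (z - y)^-1).+1; exists N; apply/eqP => eqd.
  have /andP[_ zlt] := truncn_itv (zM N).
  have /andP[yge _] := truncn_itv (yM N).
  rewrite -/(digits m N z) -eqd -addn1 natrD in zlt.
  rewrite -/(digits m N y) in yge.
  have /andP[_ Ngt] := truncn_itv zyi0; rewrite -/N in Ngt.
  have : 1 < (z - y) * (M N)%:R.
    rewrite -ltr_pdivrMl// mulr1; apply: lt_trans Ngt _.
    by rewrite ltr_nat cells_gt.
  by rewrite mulrBl; lra.
case: (ex_minnP exN) => -[|n].
  by have := digits_lt 0 y01; have := digits_lt 0 z01; rewrite !ltnS !leqn0 => /eqP -> /eqP ->.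
move=> neq min; exists n; split; first by rewrite ltn_neqAle neq digits_le.
rewrite !digits_div//; apply/eqP; apply: contraT => /min.
by rewrite ltnn.
Qed.

(** Let n.+1 be the first stage at which the digits p < q of y and z differ, and
    t = (q - p) / m_n, which is at most 1 as p and q have the same parent.
    Then z - y <= 2 t / M_n while h z - h y >= t * l_n / 2, and
    (t / 2) ^ s >= t / 2 reduces the claim to 1 / M_n <= C * l_n ^ s. *)
Lemma cantor_point_inverse_holder (s : R) : 0 <= s < 1 ->
  exists2 C : R, 0 < C & forall y z, 0 <= y < 1 -> 0 <= z < 1 ->
    `|y - z| <= C * `|h y - h z| `^ s.
Proof.
move=> s01; have [s0 s1] := andP s01.
have [C C0 CM] := cells_lower_bound s01; exists (4 * C); first by rewrite mulr_gt0.
suff main y z : 0 <= y -> y < z -> z < 1 ->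
    h y <= h z /\ z - y <= 4 * C * (h z - h y) `^ s.
  move=> y z /andP[y0 y1] /andP[z0 z1]; have [yz|zy|->] := ltgtP y z.
  - have [hyz le] := main _ _ y0 yz z1.
    by rewrite distrC [X in X `^ _]distrC !ger0_norm ?subr_ge0// ltW.
  - have [hyz le] := main _ _ z0 zy y1.
    by rewrite !ger0_norm ?subr_ge0// ltW.
  - by rewrite subrr normr0 !mulr_ge0 ?powR_ge0// ltW.
move=> y0 yz z1; have z0 : 0 <= z by rewrite (le_trans y0)// ltW.
have [n [pq same]] := first_digit_difference y0 yz z1.
move: (endpoint_sibling same (ltnW pq)).
have /andP[_ hy] := cantor_point_bounds n.+1 y0.
have /andP[hz _] := cantor_point_bounds n.+1 z0.
have yM : 0 <= y * (M n.+1)%:R by rewrite mulr_ge0.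
have zM : 0 <= z * (M n.+1)%:R by rewrite mulr_ge0.
have /andP[yp _] := truncn_itv yM; have /andP[_ zq] := truncn_itv zM.
rewrite -/(digits m n.+1 y) in yp; rewrite -/(digits m n.+1 z) in zq.
move: hy hz pq same yp zq; set p := digits m n.+1 y; set q := digits m n.+1 z.
move=> hy hz pq same yp zq cq.
pose T := (q - p)%:R : R.
have T1 : 1 <= T by rewrite ler1n subn_gt0.
have TE : T = q%:R - p%:R by rewrite /T natrB// ltnW.
have Tm : T <= (m n)%:R.
  rewrite ler_nat leq_subLR (divn_eq q (m n)) -same ltnW//.
  rewrite -addnS leq_add// ?leq_divM//.
  by rewrite ltn_mod.
have Ml : 0 < (M n)%:R :> R by rewrite ltr0n cells_gt0.
pose t := T / (m n)%:R.
have t0 : 0 < t by rewrite divr_gt0// (lt_le_trans _ T1).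
have t1 : t <= 1 by rewrite ler_pdivrMr// mul1r.
(* Subtracting one core length costs at most half a step l n / m n. *)
have hdiff : t / 2 * l n <= h z - h y.
  have -> : t / 2 * l n = T * (l n / (m n)%:R) / 2 by rewrite /t; ring.
  rewrite -/T in cq; move: cq; have := step_ge n; have := step_gt0 n.
  have := l_le_rho n.+1; move: hy hz; move: (c _ p) (c _ q) (l n / _) => cp cq d.
  move=> hy hz lr d0 sg cqE.
  have : d <= T * d by rewrite ler_peMl// ltW.
  lra.
have hpos : 0 < t / 2 * l n by rewrite mulr_gt0// divr_gt0.
split; first by rewrite -subr_ge0 (le_trans (ltW hpos)).
have zy : z - y <= 2 * t / (M n)%:R.
  rewrite ler_pdivlMr// /t mulrA ler_pdivlMr//.
  rewrite -mulrA -natrM mulrBl -[(M n * m n)%N]/(M n.+1).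
  rewrite -natr1 in zq; lra.
apply: le_trans zy _.
have inv : (M n)%:R^-1 <= C * l n `^ s.
  by rewrite invf_ple ?posrE ?mulr_gt0 ?powR_gt0// -[leLHS]mul1r ler_pdivrMr ?mulr_gt0 ?powR_gt0// mulrCA.
apply: (@le_trans _ _ (2 * t * (C * l n `^ s))).
  by rewrite ler_pM2l// mulr_gt0.
have -> : 2 * t * (C * l n `^ s) = 4 * C * (t / 2 * l n `^ s) by field.
rewrite ler_pM2l ?mulr_gt0//.
apply: (@le_trans _ _ ((t / 2 * l n) `^ s)).
  rewrite powRM ?(ltW (l_gt0 n))// ?divr_ge0 ?(ltW t0)//.
  rewrite ler_wpM2r ?powR_ge0// ger1_powR ?(ltW s1)//.
  by rewrite divr_gt0//= ler_pdivrMr// mul1r (le_trans t1)// ler1n.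
by rewrite ge0_ler_powR ?nnegrE ?(ltW hpos)// (le_trans (ltW hpos)).
Qed.

End MoatedCantorSet.

(** * Choice of the parameters and conclusion *)

(** Dependent choice of the parameters, stage by stage.  The room eps given to
    stage n.+1 is small enough both for the new cells to fit in the core of
    stage n and for their surroundings to have measure at most e / 2 ^ n.+1.
    The property Q stands for the hitting property of the annuli. *)
Lemma moat_parameters_exist (R : realType) (Q : nat -> R -> R -> Prop) (e : R) :
    0 < e ->
    (forall n (eps : R), (1 <= n)%N -> 0 < eps -> exists (m : nat) (l rho : R),
       [/\ [/\ (2 <= m)%N, 0 < l, l <= rho & rho * m%:R <= eps],
           1 <= m%:R * l `^ (1 - n%:R^-1)
         & Q n l rho]) ->
  exists (m : nat -> nat) (l rho : nat -> R),
    [/\ [/\ forall n, (2 <= m n)%N, l 0%N = 1, forall n, 0 < l n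
          & forall n, l n <= rho n],
        forall n, 2 * rho n.+1 * (m n)%:R <= l n,
        forall n, (cells m n.+1)%:R * (4 * rho n.+1) <= e / (2 ^ n.+1)%:R,
        forall n, 1 <= (cells m n)%:R * l n `^ (1 - n%:R^-1)
      & forall n, Q n.+1 (l n.+1) (rho n.+1)].
Proof.
move=> e0 step.
have step' (x : nat * R) : exists y : nat * (R * R),
    (1 <= x.1)%N -> 0 < x.2 ->
    [/\ [/\ (2 <= y.1)%N, 0 < y.2.1, y.2.1 <= y.2.2 & y.2.2 * y.1%:R <= x.2],
        1 <= y.1%:R * y.2.1 `^ (1 - x.1%:R^-1)
      & Q x.1 y.2.1 y.2.2].
  have [x1|x1] := boolP (1 <= x.1)%N; last by exists (0%N, (0, 0)).
  have [x2|x2] := ltP 0 x.2; last by exists (0%N, (0, 0)).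
  by have [m [l [rho H]]] := step _ _ x1 x2; exists (m, (l, rho)).
have [F HF] := choice step'.
pose eps (n : nat) (s : nat * (R * R)) : R :=
  Num.min (s.2.1 / 2) (e / (2 ^ n.+1)%:R / (4 * s.1%:R)).
pose next n s := F (n.+1, eps n s).
(* The state at stage n is (number of cells, (core length, outer radius)). *)
pose st := fix st n : nat * (R * R) :=
  if n is n'.+1 then ((st n').1 * (next n' (st n')).1, (next n' (st n')).2)%N
  else (1%N, (1, 1)).
pose m n := (next n (st n)).1.
pose l n := (st n).2.1; pose rho n := (st n).2.2.
have stM n : (st n).1 = cells m n by elim: n => //= n ->.
have inv n : (0 < (st n).1)%N /\ 0 < l n.
  elim: n => [|n [M0 l0]]; first by rewrite /l /= ltr01.
  have eps0 : 0 < eps n (st n).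
    by rewrite lt_min !divr_gt0 ?mulr_gt0 ?ltr0n ?expn_gt0.
  have [[m2 l0' _ _] _ _] := HF (n.+1, eps n (st n)) isT eps0.
  by split => //=; rewrite muln_gt0 M0 /= ltnW.
have eps0 n : 0 < eps n (st n).
  have [M0 l0] := inv n.
  by rewrite lt_min !divr_gt0 ?mulr_gt0 ?ltr0n ?expn_gt0.
have spec n := HF (n.+1, eps n (st n)) isT (eps0 n).
exists m, l, rho; split.
- split=> [n|//|n|[|n]].
  + by have [[]] := spec n.
  + by have [] := inv n.
  + by rewrite /l /rho /=.
  + by have [[]] := spec n.
- move=> n; have [[_ _ _]] := spec n; rewrite le_min => /andP[+ _] _ _.
  by rewrite ler_pdivlMr// mulrC mulrA.
- move=> n; have [[_ _ _]] := spec n; rewrite le_min => /andP[_ +] _ _.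
  have [M0 _] := inv n; rewrite ler_pdivlMr ?mulr_gt0 ?ltr0n//.
  apply: le_trans; rewrite /= -stM -[(F _).1]/(m n) -[(F _).2.2]/(rho n.+1) natrM.
  by rewrite le_eqVlt; apply/orP; left; apply/eqP; ring.
- case=> [|n]; first by rewrite /l /= powR1 mulr1.
  have [M0 _] := inv n; have [_ + _] := spec n => /le_trans; apply.
  rewrite ler_wpM2r ?powR_ge0// ler_nat /= -stM.
  by rewrite leq_pmull.
- by move=> n; have [] := spec n.
Qed.

Theorem theorem1p1 (R : realType) (a : nat -> R) (phi : nat -> R)
    (ha : null_sequence a)
    (hlog : forall n, (1 <= n)%N -> ln (a n / a n.+1) = expR (phi n))
    (hphi : forall m n, (1 <= m)%N -> (m < n)%N -> phi m < phi n)
    (hlim : phi n / n%:R @[n --> \oo] --> (0 : R)) :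
  forall eta : R, 0 < eta ->
    exists K : set R,
      [/\ compact K,
          (`|lebesgue_measure K - 1| < eta%:E)%E
        & hausdorff_dim (erdos_points a K) = 1%E].
Proof.
move=> eta eta0; have e0 : 0 < eta / 2 by rewrite divr_gt0.
have a1 : 0 < a 1%N by case: ha => + _ _; exact.
have ratio := null_sequence_ratio_le ha hlog hphi.
have slow c N0 (c0 : 0 < c) := subexponential_ratios_slow_decay ha N0 hlog hlim c0.
have step n eps := annulus_step ha ratio slow (n := n) (e := eps).
have [m [l [rho [[m2 l0 lgt0 lrho] fit area many hit]]]] := moat_parameters_exist e0 step.
have dilates d : 0 < d -> exists n k,
    [/\ (1 <= k)%N, 0 < a k, l n.+1 < d * a k & d * a k < rho n.+1].
  (* Stage n must have d <= n.+1 and rho n.+1 <= d * a 1; as rho n.+1 is at most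
     eta / 2 ^ n.+2, both hold once n.+1 exceeds x. *)
  move=> d0; pose x := d + eta / 2 / (d * a 1%N).
  have x0 : 0 <= x by rewrite addr_ge0 ?divr_ge0 ?mulr_ge0 ?ltW.
  pose n := Num.truncn x.
  have /andP[_ xn] := truncn_itv x0; rewrite -/n in xn.
  have dn : 0 < d <= n.+1%:R.
    by rewrite d0 (le_trans _ (ltW xn))// lerDl divr_ge0 ?mulr_ge0 ?ltW.
  have rho1 : rho n.+1 <= d * a 1%N.
    have rho0 : 0 < rho n.+1 by apply: lt_le_trans (lrho _).
    apply: (@le_trans _ _ ((cells m n.+1)%:R * (4 * rho n.+1))).
      rewrite mulrA ler_peMl ?(ltW rho0)// -natrM ler1n muln_gt0 andbT.
      exact: cells_gt0.
    apply: (le_trans (area n)); rewrite ler_pdivrMr ?ltr0n ?expn_gt0//.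
    rewrite -ler_pdivrMl ?mulr_gt0// mulrC.
    apply: (@le_trans _ _ x); first by rewrite lerDr ltW.
    by rewrite (le_trans (ltW xn))// ler_nat ltnW// ltn_expl.
  have [k [k1 lk rk]] := hit n d dn rho1; exists n, k; split => //.
  by case: ha => + _ _; exact.
exists (moated_set m l rho); split.
- exact: compact_moated_set.
- have /le_lt_trans : (`|lebesgue_measure (moated_set m l rho) - 1| <= (eta / 2)%:E)%E.
    exact: moated_set_measure.
  by apply; rewrite lte_fin ltr_pdivrMr// ltr_pMr// ltr1n.
- apply/eqP; rewrite eq_le hausdorff_dim_le1; last by move=> x [[]].
  apply: le_ereal_inf_tmp => _ [s [s0 Hs] <-]; rewrite lee_fin leNgt.
  apply/negP => s1; have s01 : 0 <= s < 1 by rewrite s0.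
  have [C C0 hol] := cantor_point_inverse_holder m2 l0 lgt0 lrho fit many s01.
  have hE y : 0 <= y < 1 -> erdos_points a (moated_set m l rho) (cantor_point m l y).
    exact: cantor_point_erdos.
  by have := hausdorff_measure_inverse_holder s0 C0 hE hol; rewrite Hs eqxx.
Qed.
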